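(* In $\mathcal{E}_3=\mathrm{End}(\mathcal{T}_3)$ the following statements hold: (1) $\mathscr{L}^*\subseteq\mathscr{R}^*=\mathscr{D}^*=\mathscr{J}^*=\widetilde{\mathscr{R}}$ and the $\mathscr{R}^*$-classes are $\mathcal{G}_3$, $E_3(3)$, $E_2(3)\cup C(3)$ and $E_1(3)$ (i.e. elements of the same rank); (2) $\alpha\mathrel{\widetilde{\mathscr{L}}}\beta$ if and only if $\alpha=\beta$ or $\alpha,\beta\in\mathcal{G}_3\cup C(3)$; (3) $\alpha\mathrel{\mathscr{L}^*}\beta$ if and only if $\alpha,\beta\in\mathcal{G}_3$ or $\alpha^2=\alpha=\beta=\beta^2$ or $\alpha=\phi_{t,e}$, $\beta=\phi_{u,f}$ both lie in $C(3)$ with $\mathrm{Fix}(t,e)=\mathrm{Fix}(u,f)$; (4) the $\widetilde{\mathscr{D}}$-classes are $\mathcal{G}_3\cup E_2(3)\cup C(3)$, $E_3(3)$ and $E_1(3)$; (5) the $\widetilde{\mathscr{J}}$-classes are $\mathcal{E}_3\setminus E_1(3)$ and $E_1(3)$.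
   Context: Maps are written on the right and composed left to right. For $n=3$: $\mathcal{T}_n$ is the full transformation semigroup of all maps $\{1,\dots,n\}\to\{1,\dots,n\}$; $\mathcal{S}_n$, $\mathcal{A}_n$ are the symmetric and alternating groups, $\mathrm{id}$ the identity map, and $s^g=g^{-1}sg$ for $g\in\mathcal{S}_n$, $s\in\mathcal{T}_n$. $\mathcal{E}_n=\mathrm{End}(\mathcal{T}_n)$ is the monoid of all semigroup endomorphisms of $\mathcal{T}_n$ (not required to fix $\mathrm{id}$), and $\mathcal{G}_n=\mathrm{Aut}(\mathcal{T}_n)$. The rank of an endomorphism is the cardinality of its image. For $g\in\mathcal{S}_n$, $\psi_g:s\mapsto s^g$. For $t,e\in\mathcal{T}_n$, $\phi_{t,e}$ sends $s\mapsto t$ if $s\in\mathcal{S}_n\setminus\mathcal{A}_n$, $s\mapsto t^2$ if $s\in\mathcal{A}_n$, $s\mapsto e$ if $s\in\mathcal{T}_n\setminus\mathcal{S}_n$. By a known theorem of Schein and Teclezghi, $\mathcal{G}_n=\{\psi_g:g\in\mathcal{S}_n\}$ and, for $n\neq4$, $\mathcal{E}_n=\mathcal{G}_n\cup\{\phi_{t,e}: t^3=t,\ te=et=e^2=e\}$. Define (in each case $\phi_{t,e}$ is assumed to lie in $\mathcal{E}_n$): $E_3(n)=\{\phi_{t,e}: t\in\mathcal{S}_n\setminus\mathcal{A}_n,\ e\ne\mathrm{id}\}$; $E_2(n)=\{\phi_{\mathrm{id},e}: e\ne\mathrm{id}\}$; $C(n)=\{\phi_{t,e}: t\in\mathcal{T}_n\setminus\mathcal{S}_n,\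 t=t^2,\ t\neq e,\ e\neq\mathrm{id}\}$; $E_1(n)=\{\phi_{e,e}\}$. $\mathrm{Fix}(t,e)=\{g\in\mathcal{S}_n: t^g=t\text{ and }e^g=e\}$. Relations on $\mathcal{E}_n$: $\alpha\mathrel{\mathscr{R}^*}\beta$ iff for all $\gamma,\delta\in\mathcal{E}_n$, $\gamma\alpha=\delta\alpha\Leftrightarrow\gamma\beta=\delta\beta$; $\alpha\mathrel{\mathscr{L}^*}\beta$ iff for all $\gamma,\delta\in\mathcal{E}_n$, $\alpha\gamma=\alpha\delta\Leftrightarrow\beta\gamma=\beta\delta$; $\alpha\mathrel{\widetilde{\mathscr{R}}}\beta$ iff for all idempotents $\eta\in\mathcal{E}_n$, $\eta\alpha=\alpha\Leftrightarrow\eta\beta=\beta$; $\alpha\mathrel{\widetilde{\mathscr{L}}}\beta$ iff for all idempotents $\eta\in\mathcal{E}_n$, $\alpha\eta=\alpha\Leftrightarrow\beta\eta=\beta$; $\mathscr{D}^*=\mathscr{L}^*\vee\mathscr{R}^*$ and $\widetilde{\mathscr{D}}=\widetilde{\mathscr{L}}\vee\widetilde{\mathscr{R}}$ (joins of equivalence relations); $\alpha\mathrel{\mathscr{J}^*}\beta$ iff $J^*(\alpha)=J^*(\beta)$ and $\alpha\mathrel{\widetilde{\mathscr{J}}}\beta$ iff $\widetilde{J}(\alpha)=\widetilde{J}(\beta)$, where $J^*(\alpha)$ [resp. $\widetilde{J}(\alpha)$] is the smallest ideal containing $\alpha$ that is a union of $\mathscr{L}^*$-classes and a union of $\mathscr{R}^*$-classes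 [resp. of $\widetilde{\mathscr{L}}$-classes and of $\widetilde{\mathscr{R}}$-classes]. *)

(* Defs.v *)
From HB Require Import structures.
From mathcomp Require Import all_boot all_fingroup all_solvable.
From Stdlib Require Import Relation_Definitions.

Set Implicit Arguments.
Unset Strict Implicit.
Unset Printing Implicit Defensive.

Local Open Scope group_scope.

(* {1, ..., n} is rendered as 'I_n = {0, ..., n-1}. *)
Definition transf (n : nat) : Type := {ffun 'I_n -> 'I_n}.

HB.instance Definition _ n := Finite.on (transf n).

(* Maps act on the right: in s * t, s is applied first (as in permM). *)
Definition transf_mul n (s t : transf n) : transf n := [ffun i => t (s i)].

Definition transf_id n : transf n := [ffun i => i].

Lemma transf_mulA n : associative (@transf_mul n).
Proof. by move=> s t u; apply/ffunP => i; rewrite !ffunE. Qed.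

Lemma transf_mul1g n : left_id (@transf_id n) (@transf_mul n).
Proof. by move=> s; apply/ffunP => i; rewrite !ffunE. Qed.

Lemma transf_mulg1 n : right_id (@transf_id n) (@transf_mul n).
Proof. by move=> s; apply/ffunP => i; rewrite !ffunE. Qed.

HB.instance Definition _ n := isSemigroup.Build (transf n) (@transf_mulA n).
HB.instance Definition _ n :=
  Semigroup_isMonoid.Build (transf n) (@transf_mul1g n) (@transf_mulg1 n).

Definition transf_of_perm n (p : 'S_n) : transf n := [ffun i => p i].

Definition symT n : {set transf n} := [set transf_of_perm p | p : 'S_n].

Definition altT n : {set transf n} :=
  [set transf_of_perm p | p in 'Alt_('I_n)].

Definition transf_conj n (s : transf n) (g : 'S_n) : transf n :=
  transf_of_perm g^-1 * s * transf_of_perm g.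

(* Finite functions rather than {multiplicative transf n -> transf n}, so that *)
(* Leibniz equality of endomorphisms is pointwise equality without axioms.    *)
Definition is_endo n (a : {ffun transf n -> transf n}) : bool :=
  [forall s : transf n, forall t : transf n, a (s * t) == a s * a t].

Record endo (n : nat) := Endo {
  endo_fun :> {ffun transf n -> transf n};
  _ : is_endo endo_fun
}.

HB.instance Definition _ n := [isSub for @endo_fun n].
HB.instance Definition _ n := [Finite of endo n by <:].

Lemma endoM n (a : endo n) : {morph a : s t / s * t}.
Proof. by move=> s t; case: a => a /= /'forall_'forall_eqP ->. Qed.

HB.instance Definition _ n (a : endo n) :=
  isMultiplicative.Build (transf n) (transf n) a (endoM a).

Lemma is_endo_comp n (a b : endo n) : is_endo [ffun s => b (a s)].
Proof. by apply/'forall_'forall_eqP => s t; rewrite !ffunE !endoM. Qed.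

Lemma is_endo_id n : is_endo [ffun s : transf n => s].
Proof. by apply/'forall_'forall_eqP => s t; rewrite !ffunE. Qed.

Definition endo_mul n (a b : endo n) : endo n := Endo (is_endo_comp a b).

Definition endo_id n : endo n := Endo (is_endo_id n).

Lemma endo_mulA n : associative (@endo_mul n).
Proof. by move=> a b c; apply/val_inj/ffunP => s; rewrite !ffunE. Qed.

Lemma endo_mul1g n : left_id (@endo_id n) (@endo_mul n).
Proof. by move=> a; apply/val_inj/ffunP => s; rewrite !ffunE. Qed.

Lemma endo_mulg1 n : right_id (@endo_id n) (@endo_mul n).
Proof. by move=> a; apply/val_inj/ffunP => s; rewrite !ffunE. Qed.

HB.instance Definition _ n := isSemigroup.Build (endo n) (@endo_mulA n).
HB.instance Definition _ n :=
  Semigroup_isMonoid.Build (endo n) (@endo_mul1g n) (@endo_mulg1 n).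

Definition endo_rank n (a : endo n) : nat := #|[set a s | s in [set: transf n]]|.

Definition phi_te n (t e : transf n) : {ffun transf n -> transf n} :=
  [ffun s => if s \in symT n :\: altT n then t
             else if s \in altT n then t * t else e].

Definition is_phi n (a : endo n) (t e : transf n) : bool := endo_fun a == phi_te t e.

Definition aut_transf n : {set endo n} :=
  [set a : endo n | injectiveb a && [forall s : transf n, s \in codom a]].

Definition phiE3 n : {set endo n} :=
  [set a | [exists t : transf n, exists e : transf n,
     [&& is_phi a t e, t \in symT n :\: altT n & e != 1]]].

Definition phiE2 n : {set endo n} :=
  [set a | [exists e : transf n, is_phi a 1 e && (e != 1)]].

Definition phiC n : {set endo n} :=
  [set a | [exists t : transf n, exists e : transf n,
     [&& is_phi a t e, t \notin symT n, t == t * t, t != e & e != 1]]].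

Definition phiE1 n : {set endo n} := [set a | [exists e : transf n, is_phi a e e]].

Definition Fix_te n (t e : transf n) : {set 'S_n} :=
  [set g | (transf_conj t g == t) && (transf_conj e g == e)].

Section GeneralizedGreen.
Variable M : monoidType.
Implicit Types (a b x y : M) (r : relation M) (I : M -> Prop).

Definition Rstar a b : Prop := forall c d : M, c * a = d * a <-> c * b = d * b.

Definition Lstar a b : Prop := forall c d : M, a * c = a * d <-> b * c = b * d.

Definition Rtilde a b : Prop :=
  forall h : M, h * h = h -> (h * a = a <-> h * b = b).

Definition Ltilde a b : Prop :=
  forall h : M, h * h = h -> (a * h = a <-> b * h = b).

(* The least equivalence relation containing r1 and r2. *)
Definition join_rel r1 r2 a b : Prop :=
  forall r, equivalence M r -> inclusion M r1 r -> inclusion M r2 r -> r a b.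

Definition Dstar : relation M := join_rel Lstar Rstar.

Definition Dtilde : relation M := join_rel Ltilde Rtilde.

Definition is_ideal I : Prop := forall x y, I x -> I (y * x) /\ I (x * y).

(* For an equivalence relation r: I is a union of r-classes. *)
Definition saturated r I : Prop := forall x y, r x y -> I x -> I y.

(* The smallest ideal containing a that is a union of r1-classes and of       *)
(* r2-classes, obtained as the intersection of all of them.                   *)
Definition principal_ideal r1 r2 a x : Prop :=
  forall I, is_ideal I -> saturated r1 I -> saturated r2 I -> I a -> I x.

Lemma principal_ideal_least r1 r2 a :
  [/\ is_ideal (principal_ideal r1 r2 a),
      saturated r1 (principal_ideal r1 r2 a),
      saturated r2 (principal_ideal r1 r2 a),
      principal_ideal r1 r2 a a
    & forall I, is_ideal I -> saturated r1 I -> saturated r2 I -> I a ->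
      forall x, principal_ideal r1 r2 a x -> I x].
Proof.
split=> [x y Jx|x y rxy Jx I Ii I1 I2 Ia|x y rxy Jx I Ii I1 I2 Ia|//|I Ii I1 I2 Ia x].
- by split=> I Ii I1 I2 Ia; have [] := Ii x y (Jx I Ii I1 I2 Ia).
- exact: I1 rxy (Jx I Ii I1 I2 Ia).
- exact: I2 rxy (Jx I Ii I1 I2 Ia).
- by apply.
Qed.

Definition Jstar a b : Prop :=
  forall x, principal_ideal Lstar Rstar a x <-> principal_ideal Lstar Rstar b x.

Definition Jtilde a b : Prop :=
  forall x, principal_ideal Ltilde Rtilde a x <-> principal_ideal Ltilde Rtilde b x.

End GeneralizedGreen.

Definition is_class (T : finType) (r : relation T) (X : {set T}) : Prop :=
  exists a, forall b, b \in X <-> r a b.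

(* Main.v *)
Require Import Defs.
From HB Require Import structures.
From mathcomp Require Import all_boot all_fingroup all_solvable.
From Stdlib Require Import Relation_Definitions.

(** Two facts about the endomorphism monoid carry the proof.

First, every endomorphism [a] of the full transformation monoid on three points
is a conjugation or some [phi_te t e] ([endo_conj_or_phi]). If [a] sends all
even permutations to [a 1], then it is constant on odd permutations and on
singular maps, because a singular idempotent [f] becomes a constant map when a
suitable 3-cycle is inserted in [f * f] ([phi_of_even_trivial]). If [a p]
differs from [a 1] for an even [p], then [a p] is a 3-cycle, which forces [a]
to permute the constant maps, and this permutation conjugates [s] to [a s]
([conj_of_even_nontrivial]). The equations satisfied by [t] and [e] then split
the maps [phi_te t e] into four families, with ranks 3, 2, 2 and 1 ([endo3P]).

Second, the rank of an endomorphism determines its kernel ([rank_ker]). With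
maps written on the right, [c * a = d * a] depends on [a] only through its
kernel, and each kernel is that of an idempotent; so R-star and R-tilde are
both equality of ranks ([Rstar_eq_rank], [Rtilde_eq_rank]).

On the other side, [a * c = a * d] compares [c] and [d] on the image of [a],
that is, on the parameters [t] and [e]. An automorphism or a member of the
family C has no idempotent right identity but [1], since an idempotent fixing
two distinct singular maps is a conjugation; all other elements are
idempotents, separated from each other by L-tilde because idempotents with the
same image and the same rank coincide ([Ltilde_iff]). Since L-star is contained
in L-tilde, only the family C remains, and there automorphisms detect exactly
the stabilizer of the pair of parameters ([Lstar_iff]).

Hence L-star preserves the rank, and D-star and J-star reduce to it as well,
the sets of elements of bounded rank being ideals. L-tilde glues ranks 27 and 2
through the family C, which gives D-tilde; for J-tilde, an ideal also reaches
rank 2 from rank 3, so that only the elements of rank 1 stay apart. *)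

Set Implicit Arguments.
Unset Strict Implicit.
Unset Printing Implicit Defensive.

Local Open Scope group_scope.
(** * Transformations, permutations and the maps phi_te *)

Section Transf.
Variable n : nat.
Implicit Types (s t e u f : transf n) (p q : 'S_n).

Definition cst (x : 'I_n) : transf n := [ffun => x].

Lemma cst_mul x s : cst x * s = cst (s x).
Proof. by apply/ffunP => i; rewrite !ffunE. Qed.

Lemma mul_cst s x : s * cst x = cst x.
Proof. by apply/ffunP => i; rewrite !ffunE. Qed.

Lemma transf_of_permM p q :
  transf_of_perm (p * q) = transf_of_perm p * transf_of_perm q.
Proof. by apply/ffunP => i; rewrite !ffunE permM. Qed.

Lemma transf_of_perm1 : transf_of_perm 1 = 1 :> transf n.
Proof. by apply/ffunP => i; rewrite !ffunE perm1. Qed.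

Lemma transf_of_perm_inj : injective (@transf_of_perm n).
Proof.
by move=> p q /ffunP pq; apply/permP => i; have := pq i; rewrite !ffunE.
Qed.

Lemma mem_symT p : transf_of_perm p \in symT n.
Proof. exact: imset_f. Qed.

Lemma mem_altT p : (transf_of_perm p \in altT n) = ~~ odd_perm p.
Proof. by rewrite mem_imset ?Alt_even //; apply: transf_of_perm_inj. Qed.

Lemma mem_oddT p : (transf_of_perm p \in symT n :\: altT n) = odd_perm p.
Proof. by rewrite inE mem_altT mem_symT andbT negbK. Qed.

Lemma symTP s : reflect (injective s) (s \in symT n).
Proof.
apply: (iffP imsetP) => [[p _ ->] i j|inj_s].
  by rewrite !ffunE; apply: perm_inj.
by exists (perm inj_s) => //; apply/ffunP => i; rewrite ffunE permE.
Qed.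

(** A composite of maps of a finite set is bijective only if both factors are:
the first is then injective, hence invertible, and can be cancelled. *)
Lemma symTM s t : (s * t \in symT n) = (s \in symT n) && (t \in symT n).
Proof.
apply/idP/andP=> [stS|[/imsetP[p _ ->] /imsetP[q _ ->]]]; last first.
  by rewrite -transf_of_permM mem_symT.
have sS: s \in symT n.
  by apply/symTP => i j ij; apply: (symTP _ stS); rewrite !ffunE ij.
split=> //; case/imsetP: sS stS => p _ -> /imsetP[q _ pt].
suff ->: t = transf_of_perm (p^-1 * q) by apply: mem_symT.
rewrite transf_of_permM -pt mulgA -transf_of_permM mulVg.
by rewrite transf_of_perm1 mul1g.
Qed.

Lemma symT1 : 1 \in symT n.
Proof. by rewrite -transf_of_perm1 mem_symT. Qed.

Lemma symT_idem_eq1 s : s \in symT n -> s * s = s -> s = 1.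
Proof.
move=> /symTP inj_s /ffunP ss; apply/ffunP => i; apply: inj_s.
by have := ss i; rewrite !ffunE.
Qed.

Lemma altT1 : 1 \in altT n.
Proof. by rewrite -transf_of_perm1 mem_altT odd_perm1. Qed.

Lemma phi_perm t e p :
  phi_te t e (transf_of_perm p) = if odd_perm p then t else t * t.
Proof. by rewrite ffunE mem_oddT mem_altT; case: odd_perm. Qed.

Lemma phi_1 t e : phi_te t e 1 = t * t.
Proof. by rewrite -transf_of_perm1 phi_perm odd_perm1. Qed.

Lemma phi_sing t e s : s \notin symT n -> phi_te t e s = e.
Proof.
move=> sS; rewrite ffunE inE (negPf sS) andbF ifN //.
by apply: contra sS => /imsetP[p _ ->]; apply: mem_symT.
Qed.

Lemma phi_odd t e s : s \in symT n :\: altT n -> phi_te t e s = t.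
Proof. by move=> so; rewrite ffunE so. Qed.

(** Odd, even and singular maps multiply like the elements of a group of order
two with a zero adjoined; the four equations say that [t], [t * t] and [e] obey
that multiplication table. *)
Lemma phi_is_endo t e :
  t * t * t = t -> t * e = e -> e * t = e -> e * e = e -> is_endo (phi_te t e).
Proof.
move=> ttt te et ee; apply/'forall_'forall_eqP => s u.
have [/imsetP[p _ ->]|sS] := boolP (s \in symT n); last first.
  rewrite !(phi_sing _ _ sS) phi_sing ?symTM ?(negPf sS) //.
  have [/imsetP[q _ ->]|uS] := boolP (u \in symT n); last by rewrite phi_sing.
  by rewrite phi_perm; case: ifP; rewrite ?mulgA ?et.
have [/imsetP[q _ ->]|uS] := boolP (u \in symT n); last first.
  rewrite !(phi_sing _ _ uS) phi_sing ?symTM ?(negPf uS) ?andbF //.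
  by rewrite phi_perm; case: ifP; rewrite -?mulgA ?te.
rewrite -transf_of_permM !phi_perm odd_permM.
by case: (odd_perm p); case: (odd_perm q); rewrite //= !mulgA ?ttt.
Qed.

Definition phi_endo t e ttt te et ee : endo n :=
  Endo (@phi_is_endo t e ttt te et ee).

Lemma transf_conjE s (g : 'S_n) i : transf_conj s g (g i) = g (s i).
Proof. by rewrite !ffunE permK. Qed.

Lemma transf_conjM s t (g : 'S_n) :
  transf_conj (s * t) g = transf_conj s g * transf_conj t g.
Proof. by apply/ffunP => i; rewrite !ffunE permK. Qed.

Lemma transf_conj_comp s (g h : 'S_n) :
  transf_conj s (g * h) = transf_conj (transf_conj s g) h.
Proof. by apply/ffunP => i; rewrite !ffunE invMg !permM. Qed.

Lemma transf_conj1 s : transf_conj s 1 = s.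
Proof. by apply/ffunP => i; rewrite !ffunE invg1 !perm1. Qed.

Lemma transf_conj_inj (g : 'S_n) : injective (fun s => transf_conj s g).
Proof.
move=> s t /(congr1 (fun u => transf_conj u g^-1)).
by rewrite -!transf_conj_comp mulgV !transf_conj1.
Qed.

Lemma psi_is_endo (g : 'S_n) : is_endo [ffun s => transf_conj s g].
Proof. by apply/'forall_'forall_eqP => s t; rewrite !ffunE transf_conjM. Qed.

Definition psi (g : 'S_n) : endo n := Endo (psi_is_endo g).

Lemma endoP (a b : endo n) : a =1 b <-> a = b.
Proof. by split=> [ab|->//]; apply/val_inj/ffunP. Qed.

Lemma endo_mulE (a b : endo n) s : (a * b) s = b (a s).
Proof. by rewrite /= ffunE. Qed.

Lemma endo_oneE s : (1 : endo n) s = s.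
Proof. by rewrite /= ffunE. Qed.

Lemma rank_mul (a b : endo n) :
  endo_rank (a * b) <= endo_rank a /\ endo_rank (a * b) <= endo_rank b.
Proof.
rewrite /endo_rank; split.
  suff -> : [set (a * b) s | s in setT] = b @: [set a s | s in setT].
    exact: leq_imset_card.
  by rewrite -imset_comp; apply: eq_imset => s; rewrite /= ffunE.
apply: subset_leq_card; apply/subsetP => x /imsetP[s _ ->].
by rewrite endo_mulE imset_f.
Qed.

End Transf.
(** * Three points and their 3-cycles *)

Lemma ord3_cover (x y z w : 'I_3) :
  x != y -> y != z -> z != x -> [\/ w = x, w = y | w = z].
Proof.
move=> xy yz zx; have: w \in [set x; y; z].
  suff ->: [set x; y; z] = setT by rewrite inE.
  apply/eqP; rewrite eqEcard subsetT cardsT card_ord setUC cardsU1 cards2.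
  by rewrite !inE negb_or zx xy (eq_sym z) yz.
rewrite !inE -orbA => /or3P[] /eqP ->.
- exact: Or31.
- exact: Or32.
- exact: Or33.
Qed.

Lemma ord3_third (x y : 'I_3) : x != y -> exists z : 'I_3, y != z /\ z != x.
Proof.
move=> xy; have: 0 < #|~: [set x; y]|.
  by rewrite cardsCs setCK card_ord cards2 xy.
case/card_gt0P => z; rewrite !inE negb_or => /andP[zx zy].
by exists z; rewrite eq_sym zy.
Qed.

Lemma even_3cycle (x y z : 'I_3) : x != y -> y != z -> z != x ->
  exists p : 'S_3, [/\ ~~ odd_perm p, p x = y, p y = z & p z = x].
Proof.
move=> xy yz zx; exists (tperm x y * tperm x z).
have [zy xz] : z != y /\ x != z by rewrite eq_sym yz eq_sym zx.
rewrite odd_permM !odd_tperm xy xz !permM tpermL tpermR tpermL.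
by rewrite (tpermD xy zy) (@tpermD _ x y z) ?tpermR // eq_sym.
Qed.

Lemma even_cube (p : 'S_3) : ~~ odd_perm p -> p * p * p = 1.
Proof.
move=> ep; have := @card_Alt 'I_3; rewrite card_ord => /(_ isT) cA.
have {}cA : #|'Alt_('I_3)| = 3.
  by apply/eqP; rewrite -(eqn_pmul2l (isT : 0 < 2)) cA.
have := @expg_cardG _ 'Alt_('I_3) p.
by rewrite Alt_even ep cA !expgS expg0 mulg1 mulgA; apply.
Qed.

(** Meant for [u = a p] where [p] is an even permutation and [a] an
endomorphism with [a p != a 1]. On its image [u] acts as a permutation of order
3, which needs three points. *)
Lemma order3_is_3cycle (u : transf 3) : u * u * u * u = u -> u * u * u != u ->
  exists y, [/\ y != u y, u y != u (u y), u (u y) != y & u (u (u y)) = y].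
Proof.
move=> u4 u3; have [x ux] : exists x, (u * u * u) x != u x.
  by apply/existsP; apply: contraR u3 => /existsPn e; apply/eqP/ffunP => x;
    apply/eqP; rewrite -[_ == _]negbK e.
have u4x : u (u (u (u x))) = u x by move/ffunP: u4 => /(_ x); rewrite !ffunE.
rewrite !ffunE in ux; exists (u x); split=> //.
  by apply: contra ux => /eqP e; rewrite -e -e.
by apply: contra ux => /eqP e; rewrite -{2}u4x -e -e.
Qed.

(** * Every endomorphism is a conjugation or some phi_te *)

Notation tp := transf_of_perm.

Lemma cst_singular (x : 'I_3) : cst x \notin symT 3.
Proof.
apply/symTP => /(_ ord0 ord_max); rewrite !ffunE => /(_ erefl) /(congr1 val).
by [].
Qed.

(** Any endomorphism that does not distinguish even permutations from [1]
identifies [f] = [f * 1 * f] with [f * p * f], a constant; then [s] = [s * f]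
is identified with a constant as well. The map [f] moves a point [z] missed by
[s] onto another point [w] and fixes the others; the 3-cycle [p] brings the
image of [f] back onto the pair [z], [w] that [f] collapses. *)
Lemma singular_collapse (s : transf 3) : s \notin symT 3 ->
  exists f w (p : 'S_3), [/\ s * f = s, f * f = f, ~~ odd_perm p
    & f * tp p * f = cst w].
Proof.
move=> sS; have [z zs] : exists z, forall i, s i != z.
  have: ~~ [forall z, z \in codom s].
    apply: contra sS => /forallP s_onto; apply/symTP => i j sij.
    have /image_injP s_inj : #|codom s| == #|'I_3|.
      by apply/eqP/eq_card => z; rewrite s_onto.
    exact: s_inj sij.
  rewrite negb_forall => /existsP[z zs]; exists z => i.
  by apply: contra zs => /eqP <-; apply: codom_f.
have [w zw] : exists w : 'I_3, z != w.
  exists (if z == ord0 then ord_max else ord0).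
  by case: ifPn => // /eqP ->.
have [v [wv vz]] := ord3_third zw.
have [zv [wz vw]] : z != v /\ (w != z /\ v != w).
  by rewrite eq_sym vz eq_sym zw eq_sym wv.
have [p [ep pz pv pw]] := even_3cycle zv vw wz.
exists [ffun i => if i == z then w else i], w, p; split=> //.
- by apply/ffunP => i; rewrite !ffunE (negPf (zs i)).
- apply/ffunP => i; rewrite !ffunE; case: (i =P z) => [_|/eqP/negPf->//].
  by rewrite (negPf wz).
apply/ffunP => i; rewrite !ffunE.
case: (ord3_cover i zv vw wz) => ->;
  by rewrite ?eqxx ?(negPf vz) ?(negPf wz) ?pz ?pv ?pw ?eqxx ?(negPf wz).
Qed.

(** If [a] does not see the even permutations, then it is constant on the odd
ones (a coset of the alternating group), on the constant maps (on which the
alternating group is transitive), and so on all singular maps by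
[singular_collapse]. *)
Lemma phi_of_even_trivial (a : endo 3) :
  (forall p : 'S_3, ~~ odd_perm p -> a (tp p) = a 1) ->
  exists t e, endo_fun a = phi_te t e.
Proof.
move=> a_even; pose o : 'S_3 := tperm ord0 ord_max.
have oo : odd_perm o by rewrite odd_tperm.
have a_cst x y : a (cst x) = a (cst y).
  have [->//|yx] := eqVneq y x; have [z [xz zy]] := ord3_third yx.
  have [p [ep py _ _]] := even_3cycle yx xz zy.
  by rewrite -py -[p y](ffunE p y) -cst_mul endoM a_even // -endoM mulg1.
exists (a (tp o)), (a (cst ord0)); apply/ffunP => s.
have [/imsetP[p _ ->]|sS] := boolP (s \in symT 3); last first.
  rewrite phi_sing //; have [f [w [p [sf ff ep fpf]]]] := singular_collapse sS.
  have af : a f = a (cst w) by rewrite -fpf !endoM a_even // -!endoM mulg1 ff.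
  by rewrite -sf endoM af -endoM mul_cst; apply: a_cst.
rewrite phi_perm; case: ifPn => [op|ep].
  have -> : p = p * o * o by rewrite -mulgA tperm2 mulg1.
  rewrite transf_of_permM endoM (a_even (p * o)) ?odd_permM ?op ?oo //.
  by rewrite -endoM mul1g.
by rewrite [LHS](a_even p ep) -endoM -transf_of_permM tperm2 transf_of_perm1.
Qed.

(** Otherwise [u = a p] is a 3-cycle. As [p * cst x = cst x], every [a (cst x)]
is constant on the orbits of [u], hence a constant map [cst (f x)]. Applying
[a] to [cst x * s = cst (s x)] gives [a s (f x) = f (s x)]: once [f] is a
bijection, [a] is the conjugation by it. *)
Lemma conj_of_even_nontrivial (a : endo 3) (p : 'S_3) :
  ~~ odd_perm p -> a (tp p) != a 1 ->
  exists g : 'S_3, forall s, a s = transf_conj s g.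
Proof.
move=> ep; set u := a (tp p) => u1.
have p3 := even_cube ep.
have u3 : u * u * u = a 1.
  by rewrite -!endoM -!transf_of_permM p3 transf_of_perm1.
have [||y [y1 y2 y3 y4]] := @order3_is_3cycle u.
- by rewrite u3 -endoM mul1g.
- by rewrite u3 eq_sym.
have u_free z : u z != z.
  case: (ord3_cover z y1 y2 y3) => -> //; first by rewrite eq_sym.
    by rewrite eq_sym.
  by rewrite y4 eq_sym.
pose f x := a (cst x) y.
have a_cst x : a (cst x) = cst (f x).
  have inv i : a (cst x) (u i) = a (cst x) i.
    by rewrite -[in RHS](mul_cst (tp p) x) endoM [in RHS]ffunE.
  apply/ffunP => i; rewrite [RHS]ffunE /f.
  by case: (ord3_cover i y1 y2 y3) => ->; rewrite ?inv.
have fs s x : a s (f x) = f (s x).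
  by have := congr1 (fun v : transf 3 => v y) (endoM a (cst x) s);
     rewrite cst_mul !a_cst !ffunE.
have inj_f : injective f.
  move=> x x' fx; apply/eqP; apply: contraT => xx'.
  (* This [s] transports the equality [f x = f x'] to [f (p x) = f x], which
     would make [f x] a fixed point of [u]. *)
  pose s : transf 3 := [ffun k => if k == x then p x else x].
  have := u_free (f x); rewrite /u fs ffunE.
  suff -> : f (p x) = f x by rewrite eqxx.
  transitivity (a s (f x)); first by rewrite fs ffunE eqxx.
  by rewrite fx fs ffunE eq_sym (negPf xx').
exists (perm inj_f) => s; apply/ffunP => i; rewrite -[i](permKV (perm inj_f)).
by rewrite transf_conjE !permE fs.
Qed.

(** * Endomorphisms of the form phi_te *)

Definition odd3 : 'S_3 := tperm ord0 ord_max.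

Lemma odd3_odd : odd_perm odd3. Proof. by rewrite odd_tperm. Qed.

Section Phi.
Variables (a : endo 3) (t e : transf 3).
Hypothesis aE : endo_fun a = phi_te t e.

Lemma phi_val_odd s : s \in symT 3 :\: altT 3 -> a s = t.
Proof. by move=> so; rewrite aE phi_odd. Qed.

Lemma phi_val_sing s : s \notin symT 3 -> a s = e.
Proof. by move=> so; rewrite aE phi_sing. Qed.

Lemma phi_val_1 : a 1 = t * t.
Proof. by rewrite aE phi_1. Qed.

Lemma phi_axioms : [/\ t * t * t = t, t * e = e, e * t = e & e * e = e].
Proof.
have at_ := phi_val_odd; have := odd3_odd; rewrite -mem_oddT => /at_ <-.
rewrite -(phi_val_sing (cst_singular ord0)) -!endoM cst_mul !mul_cst.
split=> //.
  rewrite -[in LHS]mulgA -(transf_of_permM odd3 odd3) tperm2.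
  by rewrite transf_of_perm1 mulg1.
by rewrite !phi_val_sing ?cst_singular.
Qed.

(** Composing with [b] on the right only moves the two parameters; this reduces
equations in the endomorphism monoid to equations between transformations. *)
Lemma phi_mulE (b : endo 3) : endo_fun (a * b) = phi_te (b t) (b e).
Proof.
apply/ffunP => s; rewrite endo_mulE aE !ffunE.
by case: ifP => // _; case: ifP => // _; rewrite -endoM.
Qed.

Lemma phi_image : [set a s | s in [set: transf 3]] = [set t; t * t; e].
Proof.
apply/setP => x; apply/imsetP/idP => [[s _ ->]|].
  rewrite aE !inE ffunE.
  by (case: ifP => _; last case: ifP => _); rewrite eqxx ?orbT.
have o := odd3_odd; rewrite -mem_oddT in o.
rewrite !inE -orbA => /or3P[] /eqP->.
- by exists (tp odd3); rewrite ?inE ?phi_val_odd.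
- by exists 1; rewrite ?inE ?phi_val_1.
- by exists (cst ord0); rewrite ?inE // phi_val_sing ?cst_singular.
Qed.
End Phi.

Lemma phi_inj (t e u f : transf 3) : phi_te t e = phi_te u f -> t = u /\ e = f.
Proof.
move=> /ffunP eq_phi; split.
  by have := eq_phi (tp odd3); rewrite !phi_perm odd3_odd.
by have := eq_phi (cst ord0); rewrite !phi_sing ?cst_singular.
Qed.

Lemma phi_mul_eq (a c d : endo 3) (t e : transf 3) : endo_fun a = phi_te t e ->
  (a * c = a * d <-> c t = d t /\ c e = d e).
Proof.
move=> aE; split=> [acd|[ct ce]].
  by apply: phi_inj; rewrite -!(phi_mulE aE) acd.
have acd : endo_fun (a * c) = endo_fun (a * d) by rewrite !(phi_mulE aE) ct ce.
exact: val_inj acd.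
Qed.

Lemma idem_neq1_singular (e : transf 3) :
  e * e = e -> e != 1 -> e \notin symT 3.
Proof. by move=> ee; apply: contra => eS; apply/eqP/symT_idem_eq1. Qed.

(** Even permutations of three points have order dividing 3. *)
Lemma even_involution (s : transf 3) : s \in altT 3 -> s * s * s = s -> s = 1.
Proof.
case/imsetP=> p; rewrite Alt_even => ep ->.
by rewrite -!transf_of_permM (even_cube ep) transf_of_perm1.
Qed.

(** On its image, [t] is a permutation of order at most 2 with a fixed point;
as the image has at most two points, [t] is the identity there. *)
Lemma singular_fixpoint_idem (t : transf 3) (y : 'I_3) :
  t \notin symT 3 -> t * t * t = t -> t y = y -> t * t = t.
Proof.
move=> tS /ffunP ttt ty; apply/ffunP => x; rewrite ffunE.
apply/eqP; apply: contraT => tx.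
have {}ttt z : t (t (t z)) = t z by have := ttt z; rewrite !ffunE.
(* y, t x and t (t x) are three distinct points, on each of which t is an
   involution, so t would be a permutation. *)
case/negP: tS; apply/symTP.
have yx : y != t x by apply: contra tx => /eqP e; rewrite -e ty.
have yx' : t (t x) != y.
  by apply: contra tx => /eqP e; rewrite -[X in _ == X]ttt e !ty.
have tx' : t x != t (t x) by rewrite eq_sym.
have inv z : t (t z) = z.
  by case: (ord3_cover z yx tx' yx') => ->; rewrite ?ty ?ttt.
exact: can_inj inv.
Qed.

(** * The five families and their ranks *)

Section Membership.
Variables (a : endo 3) (t e : transf 3).
Hypothesis aE : endo_fun a = phi_te t e.

Lemma phi_notin_aut : a \in aut_transf 3 = false.
Proof.
apply/negP; rewrite inE => /andP[/injectiveP inj_a _].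
have /inj_a /ffunP /(_ ord0) : a (cst ord0) = a (cst ord_max).
  by rewrite !(phi_val_sing aE) ?cst_singular.
by rewrite !ffunE.
Qed.

Lemma phi_in_E3 : (a \in phiE3 3) = (t \in symT 3 :\: altT 3) && (e != 1).
Proof.
rewrite inE; apply/existsP/idP => [[u /existsP[f /and3P[/eqP]]]|te].
  by rewrite aE => /phi_inj[-> ->] -> ->.
by exists t; apply/existsP; exists e; rewrite /is_phi aE eqxx.
Qed.

Lemma phi_in_E2 : (a \in phiE2 3) = (t == 1) && (e != 1).
Proof.
rewrite inE; apply/existsP/idP => [[f /andP[/eqP]]|/andP[/eqP t1 e1]].
  by rewrite aE => /phi_inj[-> ->] ->; rewrite eqxx.
by exists e; rewrite /is_phi aE t1 eqxx.
Qed.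

Lemma phi_in_C :
  (a \in phiC 3) = [&& t \notin symT 3, t == t * t, t != e & e != 1].
Proof.
rewrite inE; apply/existsP/idP => [[u /existsP[f /andP[/eqP]]]|te].
  by rewrite aE => /phi_inj[-> ->] ->.
by exists t; apply/existsP; exists e; rewrite /is_phi aE eqxx.
Qed.

Lemma phi_in_E1 : (a \in phiE1 3) = (t == e).
Proof.
rewrite inE; apply/existsP/idP => [[f /eqP]|/eqP te].
  by rewrite aE => /phi_inj[-> ->]; rewrite eqxx.
by exists e; rewrite /is_phi aE te.
Qed.

End Membership.

(** The theorem of Schein and Teclezghi for three points. *)
Lemma endo_conj_or_phi (a : endo 3) :
  (exists g : 'S_3, forall s, a s = transf_conj s g) \/
  exists t e, endo_fun a = phi_te t e.
Proof.
have [/existsP[p /andP[ep ap]]|/existsPn ev] :=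
    boolP [exists p : 'S_3, ~~ odd_perm p && (a (tp p) != a 1)].
  by left; apply: conj_of_even_nontrivial ap.
right; apply: phi_of_even_trivial => p ep; apply/eqP.
by have := ev p; rewrite ep negbK.
Qed.

(** The indices are the truth values of membership in the five families and the
rank, so that a case analysis by [endo3P] rewrites all of them at once. *)
Variant endo3_spec (a : endo 3) :
    bool -> bool -> bool -> bool -> bool -> nat -> Prop :=
| Endo3Aut g of (forall s, a s = transf_conj s g) :
    endo3_spec a true false false false false 27
| Endo3E3 t e of endo_fun a = phi_te t e & t \in symT 3 :\: altT 3 & t * t = 1
      & e \notin symT 3 :
    endo3_spec a false true false false false 3
| Endo3E2 e of endo_fun a = phi_te 1 e & e \notin symT 3 :
    endo3_spec a false false true false false 2
| Endo3C t e of endo_fun a = phi_te t e & t \notin symT 3 & e \notin symT 3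
      & t * t = t & t != e :
    endo3_spec a false false false true false 2
| Endo3E1 e of endo_fun a = phi_te e e & e * e = e :
    endo3_spec a false false false false true 1.

Lemma endo3P (a : endo 3) :
  endo3_spec a (a \in aut_transf 3) (a \in phiE3 3) (a \in phiE2 3)
    (a \in phiC 3) (a \in phiE1 3) (endo_rank a).
Proof.
have [[g ag]|[t [e aE]]] := endo_conj_or_phi a.
- have inj_a : injective a.
    by move=> s s'; rewrite !ag; apply: transf_conj_inj.
  have aA : a \in aut_transf 3.
    rewrite inE; apply/andP; split; first exact/injectiveP.
    by apply/forallP => s; rewrite (inj_card_onto inj_a).
  have not_phi t e : endo_fun a = phi_te t e -> False.
    by move/phi_notin_aut; rewrite aA.
  rewrite aA.
  have -> : a \in phiE3 3 = false.
    by apply/negP; rewrite inE => /existsP[t /existsP[e /andP[/eqP/not_phi]]].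
  have -> : a \in phiE2 3 = false.
    by apply/negP; rewrite inE => /existsP[e /andP[/eqP/not_phi]].
  have -> : a \in phiC 3 = false.
    by apply/negP; rewrite inE => /existsP[t /existsP[e /andP[/eqP/not_phi]]].
  have -> : a \in phiE1 3 = false.
    by apply/negP; rewrite inE => /existsP[e /eqP/not_phi].
  have -> : endo_rank a = 27.
    by rewrite /endo_rank card_imset // cardsT card_ffun !card_ord.
  exact: Endo3Aut ag.
have [ttt te et ee] := phi_axioms aE.
rewrite (phi_notin_aut aE) (phi_in_E3 aE) (phi_in_E2 aE).
rewrite (phi_in_C aE) (phi_in_E1 aE).
rewrite /endo_rank (phi_image aE).
have [tE|nte] := eqVneq t e.
  subst t; rewrite ee !setUid cards1 !andbF.
  have -> : (e \in symT 3 :\: altT 3) && (e != 1) = false.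
    apply/negP => /andP[eo e1].
    by have := idem_neq1_singular ee e1; move: eo; rewrite inE => /andP[_ ->].
  have -> : (e == 1) && (e != 1) = false by case: (e == 1).
  exact: Endo3E1 aE ee.
have e1 : e != 1 by apply: contra nte => /eqP eE; rewrite -te eE mulg1.
have eS := idem_neq1_singular ee e1.
have nS s : s \in symT 3 -> s != e by move=> sS; apply: contraNneq eS => <-.
rewrite e1 !andbT; have [tS|tS] := boolP (t \in symT 3).
  have tt : t * t = 1.
    apply: symT_idem_eq1; first by rewrite symTM tS.
    by rewrite !mulgA ttt.
  rewrite tt inE tS andbT; have [tA|tA] := boolP (t \in altT 3).
    have t1 := even_involution tA ttt; subst t; rewrite eqxx setUid cards2 nte.
    exact: Endo3E2 aE eS.
  have t1 : t != 1 by apply: contraNneq tA => ->; rewrite altT1.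
  rewrite (negPf t1) setUC cardsU1 cards2 !inE t1 negb_or eq_sym nte eq_sym.
  rewrite nS ?symT1 //.
  by apply: Endo3E3 aE _ tt eS; rewrite inE tS tA.
have tt : t * t = t.
  apply: (@singular_fixpoint_idem t (e ord0)) => //.
  by move/ffunP: et => /(_ ord0); rewrite ffunE.
have t1 : t != 1 by apply: contraNneq tS => ->; rewrite symT1.
rewrite tt inE (negPf tS) (negPf t1) andbF eqxx setUid cards2 nte.
exact: Endo3C aE tS eS tt nte.
Qed.

(** * Generalized Green relations in an arbitrary monoid *)

Section MonoidGreen.
Variable M : monoidType.
Implicit Types a b : M.

Lemma Rstar_equivalence : equivalence M (@Rstar M).
Proof.
split=> [a c d //|a b c ab bc x y|a b ab c d]; last by split=> /ab.
by split=> [/ab/bc|/bc/ab].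
Qed.

Lemma Rstar_Rtilde a b : Rstar a b -> Rtilde a b.
Proof. by move=> ab h _; have := ab h 1; rewrite !mul1g. Qed.

Lemma Lstar_Ltilde a b : Lstar a b -> Ltilde a b.
Proof. by move=> ab h _; have := ab h 1; rewrite !mulg1. Qed.

Lemma join_rel_l (r1 r2 : relation M) a b : r1 a b -> join_rel r1 r2 a b.
Proof. by move=> ab r _ r1r _; apply: r1r. Qed.

Lemma join_rel_r (r1 r2 : relation M) a b : r2 a b -> join_rel r1 r2 a b.
Proof. by move=> ab r _ _; apply. Qed.

Lemma join_rel_trans (r1 r2 : relation M) : transitive M (join_rel r1 r2).
Proof.
move=> a b c ab bc r re r1r r2r; case: (re) => _ tr _.
by apply: tr (ab r re r1r r2r) (bc r re r1r r2r).
Qed.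

Lemma principal_ideal_trans (r1 r2 : relation M) a b :
  principal_ideal r1 r2 b a ->
  forall x, principal_ideal r1 r2 a x -> principal_ideal r1 r2 b x.
Proof. by move=> Jba x Jax I Ii I1 I2 Ib; apply: Jax => //; apply: Jba. Qed.

Lemma principal_ideal_self (r1 r2 : relation M) a : principal_ideal r1 r2 a a.
Proof. by move=> I. Qed.

Lemma principal_ideal_r (r1 r2 : relation M) a b :
  r2 a b -> principal_ideal r1 r2 a b.
Proof. by move=> ab I _ _ I2; apply: I2. Qed.

End MonoidGreen.

(** If [r] is equality of an invariant [f], then its classes are the level sets
of [f], one for each value. *)
Lemma is_class_levels (T : finType) (K : eqType) (r : relation T) (f : T -> K)
    (ks : seq K) :
  (forall a b, r a b <-> f a = f b) ->
  (forall a, f a \in ks) -> (forall k, k \in ks -> exists a, f a = k) ->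
  forall X, is_class r X <-> X \in [seq [set a | f a == k] | k <- ks].
Proof.
move=> rf fks ks_f X; split=> [[a Xa]|/mapP[k /ks_f[a <-] ->]].
  apply/mapP; exists (f a) => //; apply/setP => b; rewrite inE eq_sym.
  by apply/idP/eqP => [/Xa/rf|/rf/Xa].
by exists a => b; rewrite inE eq_sym; split=> [/eqP/rf|/rf/eqP].
Qed.

(** * Right-hand relations and the rank *)

(** The kernel of [phi_te t e] is determined by which of [t], [t * t] and [e]
coincide. *)
Lemma phi_ker (t e u f s s' : transf 3) :
  (t = t * t -> u = u * u) -> (t = e -> u = f) -> (t * t = e -> u * u = f) ->
  phi_te t e s = phi_te t e s' -> phi_te u f s = phi_te u f s'.
Proof.
move=> tt te tte; rewrite !ffunE.
case: ifP => _; [|case: ifP => _]; (case: ifP => _; [|case: ifP => _]) => //;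
  by [move/tt|move/te|move/tte|move/esym/tt|move/esym/te|move/esym/tte].
Qed.

(** The rank determines the kernel. Kernels are equality (rank 27), the
partition into odd, even and singular maps (rank 3), the partition into
permutations and singular maps (rank 2, where [t * t = t]), and the full
relation (rank 1). *)
Lemma rank_ker (a b : endo 3) : endo_rank a = endo_rank b ->
  forall s s', a s = a s' -> b s = b s'.
Proof.
have kerA (t e u f : transf 3) : t * t <> t -> t <> e -> t * t <> e ->
  forall s s', phi_te t e s = phi_te t e s' -> phi_te u f s = phi_te u f s'.
  by move=> tt te tte s s'; apply: phi_ker => [/esym|/te|/tte].
have ker2 (t e u f : transf 3) : u * u = u -> t <> e -> t * t <> e ->
  forall s s', phi_te t e s = phi_te t e s' -> phi_te u f s = phi_te u f s'.
  by move=> uu te tte s s'; apply: phi_ker => [_|/te|/tte].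
have sing1 (e : transf 3) : e \notin symT 3 -> 1 <> e.
  by move=> eS e1; move: eS; rewrite -e1 symT1.
case: (endo3P a) => [g ag|t e aE to tt eS|e aE eS
    |t e aE tS eS tt /eqP te|e aE ee];
  case: (endo3P b) => [h bh|u f bE uo uu fS|f bE fS
    |u f bE uS fS uu uf|f bE ff] // _ s s'.
- by rewrite !ag !bh => /transf_conj_inj ->.
- rewrite aE bE; apply: kerA; rewrite ?tt; last exact: sing1.
    by move=> t1; move: to; rewrite -t1 inE altT1.
  by move=> te; move: eS to; rewrite -te inE => /negPf->; rewrite andbF.
- by rewrite aE bE; apply: ker2; rewrite ?mulg1 //; apply: sing1.
- by rewrite aE bE; apply: ker2; rewrite ?mulg1 //; apply: sing1.
- by rewrite aE bE; apply: ker2; rewrite ?tt ?mulg1.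
- by rewrite aE bE; apply: ker2; rewrite ?tt ?mulg1.
- by rewrite aE bE; apply: phi_ker; rewrite ?ff.
Qed.

(** [c * a = d * a] says that [c s] and [d s] always lie in the same kernel
class of [a]. *)
Lemma rank_Rstar (a b : endo 3) : endo_rank a = endo_rank b -> Rstar a b.
Proof.
have half (x y c d : endo 3) :
    endo_rank x = endo_rank y -> c * x = d * x -> c * y = d * y.
  move=> xy cd; apply/endoP => s; rewrite !endo_mulE; apply: (rank_ker xy).
  by rewrite -!endo_mulE cd.
by move=> ab c d; split; apply: half.
Qed.

Lemma endo_idem (h : endo 3) s : h * h = h -> h (h s) = h s.
Proof. by move=> hh; rewrite -endo_mulE hh. Qed.

Lemma phi_idem (a : endo 3) t e :
  endo_fun a = phi_te t e -> a t = t -> a e = e -> a * a = a.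
Proof.
move=> aE at_t ae_e.
by have := phi_mulE aE a; rewrite at_t ae_e -aE => /val_inj.
Qed.

Lemma one_in_aut : (1 : endo 3) \in aut_transf 3.
Proof.
rewrite inE; apply/andP; split.
  by apply/injectiveP => s s'; rewrite !endo_oneE.
by apply/forallP => s; rewrite -[s]endo_oneE codom_f.
Qed.

Lemma rank_one : endo_rank (1 : endo 3) = 27.
Proof. by have := one_in_aut; case: endo3P. Qed.

Lemma exists_E3 : exists a : endo 3, a \in phiE3 3.
Proof.
pose m : 'I_3 := Ordinal (isT : 1 < 3).
have tt : tp odd3 * tp odd3 = 1.
  by rewrite -transf_of_permM tperm2 transf_of_perm1.
have et : cst m * tp odd3 = cst m by rewrite cst_mul ffunE tpermD.
have ttt : tp odd3 * tp odd3 * tp odd3 = tp odd3 by rewrite tt mul1g.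
exists (phi_endo ttt (mul_cst _ _) et (mul_cst _ _)).
rewrite (@phi_in_E3 _ (tp odd3) (cst m)) // mem_oddT odd3_odd.
by apply: contraNneq (cst_singular m) => ->; rewrite symT1.
Qed.

Lemma exists_phi_1 (e : transf 3) :
  e * e = e -> exists a : endo 3, endo_fun a = phi_te 1 e.
Proof.
have t3 : 1 * 1 * 1 = 1 :> transf 3 by rewrite !mulg1.
by move=> ee; exists (phi_endo t3 (mul1g e) (mulg1 e) ee).
Qed.

Lemma exists_C : exists a : endo 3, a \in phiC 3.
Proof.
pose t : transf 3 := [ffun i => if i == ord0 then ord_max else i].
have tt : t * t = t.
  by apply/ffunP => i; rewrite !ffunE; case: (i =P ord0) => [_|/eqP/negPf->].
have et : cst ord_max * t = cst ord_max by rewrite cst_mul ffunE.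
have ttt : t * t * t = t by rewrite !tt.
exists (phi_endo ttt (mul_cst _ _) et (mul_cst _ _)).
rewrite (@phi_in_C _ t (cst ord_max)) // tt eqxx.
have tm : t ord_max = t ord0 by rewrite !ffunE.
have tS : t \notin symT 3 by apply/symTP => /(_ _ _ tm).
have e1 : cst ord_max != 1 :> transf 3.
  by apply: contraNneq (cst_singular ord_max) => ->; rewrite symT1.
rewrite tS e1 andbT; apply/eqP => /ffunP /(_ (Ordinal (isT : 1 < 3))).
by rewrite !ffunE.
Qed.

Lemma aut_rank (a : endo 3) : (a \in aut_transf 3) = (endo_rank a == 27).
Proof. by case: endo3P. Qed.

Lemma E3_rank (a : endo 3) : (a \in phiE3 3) = (endo_rank a == 3).
Proof. by case: endo3P. Qed.

Lemma E2C_rank (a : endo 3) : (a \in phiE2 3 :|: phiC 3) = (endo_rank a == 2).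
Proof. by rewrite inE; case: endo3P. Qed.

Lemma E1_rank (a : endo 3) : (a \in phiE1 3) = (endo_rank a == 1%N).
Proof. by case: endo3P. Qed.

Lemma endo_rank_values (a : endo 3) : endo_rank a \in [:: 27; 3; 2; 1%N].
Proof. by case: endo3P. Qed.

(** Such an [a] is some [phi_te t e] that fixes both of its parameters, and [a
* a = phi_te (a t) (a e)]. *)
Lemma notin_autC_idem (a : endo 3) :
  a \notin aut_transf 3 :|: phiC 3 -> a * a = a /\ a <> 1.
Proof.
move=> aN; split; last by move=> a1; move: aN; rewrite a1 inE one_in_aut.
move: aN; rewrite inE.
case: endo3P => [//|t e aE to tt eS|e aE eS|//|e aE ee] _.
- exact: phi_idem aE (phi_val_odd aE to) (phi_val_sing aE eS).
- by apply: (phi_idem aE _ (phi_val_sing aE eS)); rewrite (phi_val_1 aE) mulg1.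
suff ae : a e = e by exact: (phi_idem aE).
have [eS|eS] := boolP (e \in symT 3); last by rewrite (phi_val_sing aE).
by rewrite (symT_idem_eq1 eS ee) (phi_val_1 aE) !(symT_idem_eq1 eS ee) mulg1.
Qed.

(** An automorphism has the rank of [1], a member [phi_te t e] of the family C
that of [phi_te 1 e]; everything else is idempotent already. *)
Lemma exists_idem_same_rank (a : endo 3) :
  exists h : endo 3, h * h = h /\ endo_rank h = endo_rank a.
Proof.
have [|/notin_autC_idem[aa _]] := boolP (a \in aut_transf 3 :|: phiC 3);
  last by exists a.
rewrite inE; case: endo3P => // [g _ _|t e aE _ eS _ _ _].
  by exists 1; rewrite mulg1 rank_one.
have [_ _ _ ee] := phi_axioms aE.
have [h hE] := exists_phi_1 ee; exists h; split.
  by apply: (phi_idem hE _ (phi_val_sing hE eS)); rewrite (phi_val_1 hE) mulg1.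
have : h \in phiE2 3.
  by rewrite (phi_in_E2 hE) eqxx; apply: contraNneq eS => ->; rewrite symT1.
by case: endo3P.
Qed.

(** An idempotent [h] of the same rank as [x] has the same kernel, so [h * x =
x]. If [x] and [y] are related then [h * y = y] too, and the rank of [y] is at
most that of [h]. *)
Lemma Rtilde_rank (a b : endo 3) : Rtilde a b -> endo_rank a = endo_rank b.
Proof.
have half (x y : endo 3) : Rtilde x y -> endo_rank y <= endo_rank x.
  move=> xy; have [h [hh hx]] := exists_idem_same_rank x.
  have {}xy := (xy h hh).1; rewrite -hx -xy; first by case: (rank_mul h y).
  apply/endoP => s; rewrite endo_mulE; apply: (rank_ker hx).
  exact: endo_idem.
move=> ab; apply/eqP; rewrite eqn_leq !half // => h hh.
exact: iff_sym (ab h hh).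
Qed.

Lemma Rstar_eq_rank (a b : endo 3) : Rstar a b <-> endo_rank a = endo_rank b.
Proof. by split=> [/Rstar_Rtilde/Rtilde_rank|/rank_Rstar]. Qed.

Lemma Rtilde_eq_rank (a b : endo 3) : Rtilde a b <-> endo_rank a = endo_rank b.
Proof. by split=> [/Rtilde_rank|/rank_Rstar/Rstar_Rtilde]. Qed.

(** * Left-hand relations *)

(** For [a = phi_te t e] in the family C, both [t] and [e] are singular, and an
endomorphism that fixes these two distinct singular maps is injective, being a
conjugation. *)
Lemma autC_right_idem_eq1 (a h : endo 3) :
  a \in aut_transf 3 :|: phiC 3 -> h * h = h -> a * h = a -> h = 1.
Proof.
move=> aC hh ah; have ha s : h (a s) = a s by rewrite -endo_mulE ah.
apply/endoP => s; rewrite endo_oneE; move: aC; rewrite inE.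
case: (endo3P a) => // [g ag _|t e aE tS eS tt te _].
  have := ha (transf_conj s g^-1).
  by rewrite ag -transf_conj_comp mulVg transf_conj1.
have at_ : a (tp odd3) = t by rewrite (phi_val_odd aE) // mem_oddT odd3_odd.
have ht : h t = t by rewrite -at_ ha.
have he : h e = e by rewrite -{1}(phi_val_sing aE eS) ha (phi_val_sing aE).
have hs := endo_idem s hh.
have [[k hk]|[u [f hE]]] := endo_conj_or_phi h.
  by apply: (@transf_conj_inj _ k); rewrite -!hk.
by case/eqP: te; rewrite -ht -he !(phi_val_sing hE).
Qed.

(** Outside of the automorphisms and the family C everything is idempotent and
different from [1], so it is a right identity for itself, which neither
automorphisms nor members of C allow. Two idempotents [a], [b] with [a * b = a]
and [b * a = b] have the same image, thus the same rank and the same kernel,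
and an idempotent is determined by its image and its kernel. *)
Lemma Ltilde_iff (a b : endo 3) :
  Ltilde a b <->
  a = b \/ (a \in aut_transf 3 :|: phiC 3 /\ b \in aut_transf 3 :|: phiC 3).
Proof.
have Lne x y : x \in aut_transf 3 :|: phiC 3 ->
    y \notin aut_transf 3 :|: phiC 3 ->
    ~ (x * y = x <-> y * y = y).
  move=> xA /notin_autC_idem[yy y1] xy.
  by apply: y1; apply: autC_right_idem_eq1 xA yy (xy.2 yy).
split=> [ab|[->//|[aA bA] h hh]]; last first.
  by split=> [/(autC_right_idem_eq1 aA hh)|/(autC_right_idem_eq1 bA hh)] ->;
    rewrite mulg1.
have [aA|aN] := boolP (a \in _); have [bA|bN] := boolP (b \in _).
- by right.
- by case: (Lne a b aA bN); apply: ab; case: (notin_autC_idem bN).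
- case: (Lne b a bA aN); apply: iff_sym; apply: ab.
  by case: (notin_autC_idem aN).
left; have [aa _] := notin_autC_idem aN; have [bb _] := notin_autC_idem bN.
have ab_a : a * b = a by apply/(ab b bb).
have ba_b : b * a = b by apply/(ab a aa).
have rab : endo_rank a = endo_rank b.
  apply/eqP; rewrite eqn_leq -{1}ab_a -{3}ba_b.
  by rewrite (proj2 (rank_mul a b)) (proj2 (rank_mul b a)).
apply/endoP => s; rewrite -[in LHS]ab_a endo_mulE.
exact: (rank_ker rab) (endo_idem s aa).
Qed.

(** The stabilizer of the parameters can be read off the right multiplications
of [a] by automorphisms. *)
Lemma mem_Fix_te (a : endo 3) (t e : transf 3) (g : 'S_3) :
  endo_fun a = phi_te t e -> (g \in Fix_te t e <-> a * psi g = a * 1).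
Proof.
move=> aE; rewrite inE; split=> [/andP[/eqP gt /eqP ge]|/(phi_mul_eq _ _ aE)].
  by apply/(phi_mul_eq _ _ aE); rewrite !endo_oneE !ffunE.
by rewrite !endo_oneE !ffunE => -[-> ->]; rewrite !eqxx.
Qed.

(** Both sides compare [c] and [d] on two distinct singular maps. Two
conjugations agree there exactly when their quotient is in the stabilizer; two
maps phi agree when their values on singular maps do, whichever the points are;
a conjugation separates the points while a map phi does not. *)
Lemma Lstar_C_of_Fix (a b c d : endo 3) (t e u f : transf 3) :
  a \in phiC 3 -> b \in phiC 3 ->
  endo_fun a = phi_te t e -> endo_fun b = phi_te u f ->
  Fix_te t e = Fix_te u f ->
  a * c = a * d -> b * c = b * d.
Proof.
move=> aC bC aE bE FixE /(phi_mul_eq _ _ aE)[ct ce]; apply/(phi_mul_eq _ _ bE).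
move: aC bC; rewrite (phi_in_C aE) (phi_in_C bE).
move=> /and4P[tS _ te e1] /and4P[uS _ uf f1].
have [_ _ _ ee] := phi_axioms aE; have eS := idem_neq1_singular ee e1.
have [_ _ _ ff] := phi_axioms bE; have fS := idem_neq1_singular ff f1.
have [[g cg]|[v [k cE]]] := endo_conj_or_phi c;
  have [[h dh]|[w [l dE]]] := endo_conj_or_phi d.
- have: g * h^-1 \in Fix_te t e.
    rewrite inE !transf_conj_comp -!cg ct ce !dh -!transf_conj_comp mulgV.
    by rewrite !transf_conj1 !eqxx.
  rewrite FixE inE !transf_conj_comp -!cg => /andP[/eqP gu /eqP gf].
  by split; apply: (@transf_conj_inj _ h^-1);
    rewrite /= dh -transf_conj_comp mulgV transf_conj1.
- case/eqP: te; apply: (@transf_conj_inj _ g).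
  by rewrite /= -!cg ct ce !(phi_val_sing dE).
- case/eqP: te; apply: (@transf_conj_inj _ h).
  by rewrite /= -!dh -ct -ce !(phi_val_sing cE).
by move: ce; rewrite !(phi_val_sing cE) // !(phi_val_sing dE).
Qed.

Lemma aut_mul_inj (a c d : endo 3) :
  a \in aut_transf 3 -> a * c = a * d -> c = d.
Proof.
rewrite inE => /andP[_ /forallP a_onto] acd; apply/endoP => s.
by have /codomP[s' ->] := a_onto s; rewrite -!endo_mulE acd.
Qed.

Lemma phiC_params (a : endo 3) :
  a \in phiC 3 -> exists t e, endo_fun a = phi_te t e.
Proof.
by rewrite inE => /existsP[t /existsP[e /andP[/eqP aE _]]]; exists t, e.
Qed.

(** With [p = phi_te 1 e], left multiplication by [b = phi_te t e] identifies
[p] with [b * b]; automorphisms are cancellable and do not. *)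
Lemma not_Lstar_aut_C (a b : endo 3) :
  a \in aut_transf 3 -> b \in phiC 3 -> ~ Lstar a b.
Proof.
move=> aA bC ab; have [t [e bE]] := phiC_params bC.
move: bC; rewrite (phi_in_C bE) => /and4P[tS /eqP tt _ e1].
have [_ _ _ ee] := phi_axioms bE; have eS := idem_neq1_singular ee e1.
have [p pE] := exists_phi_1 ee.
have bt := phi_val_sing bE tS; have be := phi_val_sing bE eS.
have pb : p = b * b.
  apply: (aut_mul_inj aA); apply/ab/(phi_mul_eq _ _ bE).
  by rewrite !endo_mulE bt be (phi_val_sing pE tS) (phi_val_sing pE eS) be.
have := congr1 (fun x : endo 3 => x 1) pb.
rewrite (phi_val_1 pE) mulg1 endo_mulE (phi_val_1 bE) -tt bt => /esym/eqP.
exact/negP.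
Qed.

Lemma Lstar_iff (a b : endo 3) :
  Lstar a b <->
  (a \in aut_transf 3 /\ b \in aut_transf 3) \/
  (a * a = a /\ a = b /\ b = b * b) \/
  (a \in phiC 3 /\ b \in phiC 3 /\
   exists t e u f : transf 3,
     endo_fun a = phi_te t e /\ endo_fun b = phi_te u f /\
     Fix_te t e = Fix_te u f).
Proof.
split=> [ab|[[aA bA] c d|[[_ [-> _]]//|[aC [bC [t [e [u [f fix_ab]]]]]] c d]]].
- have [eqab|[]] := (Ltilde_iff a b).1 (Lstar_Ltilde ab).
    subst b.
    have [|/notin_autC_idem[aa _]] := boolP (a \in aut_transf 3 :|: phiC 3).
      rewrite inE => /orP[aA|aC]; [by left|right; right; do 2!split=> //].
      by have [t [e aE]] := phiC_params aC; exists t, e, t, e.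
    by right; left.
  rewrite !in_setU => /orP[aA|aC] /orP[bA|bC].
  + by left.
  + by case: (not_Lstar_aut_C aA bC).
  + by case: (not_Lstar_aut_C bA aC) => c d; apply: iff_sym.
  right; right; do 2!split=> //.
  have [t [e aE]] := phiC_params aC; have [u [f bE]] := phiC_params bC.
  exists t, e, u, f; do 2!split=> //; apply/setP => g; apply/idP/idP.
    by move/(mem_Fix_te g aE)/ab/(mem_Fix_te g bE).
  by move/(mem_Fix_te g bE)/ab/(mem_Fix_te g aE).
- by split=> [/(aut_mul_inj aA)|/(aut_mul_inj bA)] ->.
have [aE [bE FixE]] := fix_ab; split; first exact: Lstar_C_of_Fix aE bE FixE.
exact: Lstar_C_of_Fix bE aE (esym FixE).
Qed.

(** * Joins and ideals *)

Lemma Lstar_Rstar (a b : endo 3) : Lstar a b -> Rstar a b.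
Proof.
move=> /Lstar_iff ab; apply/Rstar_eq_rank.
case: ab => [[]|[[_ [->]]//|[aC [bC _]]]].
  by rewrite !aut_rank => /eqP-> /eqP->.
have rC x : x \in phiC 3 -> endo_rank x = 2.
  by move=> xC; apply/eqP; rewrite -E2C_rank inE xC orbT.
by rewrite !rC.
Qed.

Lemma Dstar_eq_rank (a b : endo 3) : Dstar a b <-> endo_rank a = endo_rank b.
Proof.
split=> [ab|ab]; last by apply: join_rel_r; apply/Rstar_eq_rank.
apply/Rstar_eq_rank; apply: ab => //; first exact: Rstar_equivalence.
exact: Lstar_Rstar.
Qed.

(** The maps of rank at most [k] form an ideal, which is a union of classes
because both relations preserve the rank. *)
Lemma Jstar_eq_rank (a b : endo 3) : Jstar a b <-> endo_rank a = endo_rank b.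
Proof.
have le_rank (x y : endo 3) :
    principal_ideal (@Lstar _) (@Rstar _) x y -> endo_rank y <= endo_rank x.
  move/(_ (fun z => endo_rank z <= endo_rank x)); apply=> //.
  - move=> z w zx; have [_ wz] := rank_mul w z; have [zw _] := rank_mul z w.
    by rewrite (leq_trans wz zx) (leq_trans zw zx).
  - by move=> z w /Lstar_Rstar/Rstar_eq_rank->.
  - by move=> z w /Rstar_eq_rank->.
split=> [ab|ab x].
  apply/eqP; rewrite eqn_leq; apply/andP; split; apply: le_rank.
    by apply/ab; apply: principal_ideal_self.
  by apply/ab; apply: principal_ideal_self.
by split; apply: principal_ideal_trans; apply: principal_ideal_r;
  apply/Rstar_eq_rank.
Qed.

(** The relation L-tilde glues the automorphisms (rank 27) to the family C of
rank 2. *)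
Definition merged_rank (a : endo 3) :=
  if endo_rank a == 27 then 2 else endo_rank a.

Lemma Dtilde_eq_merged_rank (a b : endo 3) :
  Dtilde a b <-> merged_rank a = merged_rank b.
Proof.
rewrite /merged_rank; split=> [ab|].
  apply: (ab (fun x y => merged_rank x = merged_rank y)).
  - by split=> [x //|x y z xy yz|x y xy]; rewrite ?xy // -xy.
  - have autC x : x \in aut_transf 3 :|: phiC 3 -> merged_rank x = 2.
      by rewrite /merged_rank in_setU; case: endo3P.
    by move=> x y /Ltilde_iff[->//|[/autC-> /autC->]].
  - by move=> x y /Rtilde_eq_rank; rewrite /merged_rank => ->.
have [c cC] := exists_C.
have rc : endo_rank c = 2 by apply/eqP; rewrite -E2C_rank inE cC orbT.
have toC x : endo_rank x \in [:: 27; 2] -> Dtilde x c /\ Dtilde c x.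
  rewrite !inE => /orP[xA|/eqP xr]; last first.
    by split; apply: join_rel_r; apply/Rtilde_eq_rank; rewrite xr rc.
  have {}xA : x \in aut_transf 3 :|: phiC 3 by rewrite in_setU aut_rank xA.
  have cA : c \in aut_transf 3 :|: phiC 3 by rewrite in_setU cC orbT.
  by split; apply: join_rel_l; apply/Ltilde_iff; right.
have [ab _|nab ab] := eqVneq (endo_rank a) (endo_rank b).
  by apply: join_rel_r; apply/Rtilde_eq_rank.
suff /andP[/toC[ac _] /toC[_ cb]] :
    (endo_rank a \in [:: 27; 2]) && (endo_rank b \in [:: 27; 2]).
  exact: join_rel_trans ac cb.
have := endo_rank_values a; have := endo_rank_values b; move: nab ab.
rewrite !inE => nab ab /or4P[] /eqP rb /or4P[] /eqP ra; move: nab ab;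
  by rewrite ra rb.
Qed.

(** The elements of rank 1 form an ideal. Any saturated ideal [I] containing an
element of larger rank contains [1]: from rank 3, multiplying by [phi_te 1 e]
leads to rank 2, R-tilde leads from there to the family C, and L-tilde from
there to [1]. *)
Lemma Jtilde_eq_rank1 (a b : endo 3) :
  Jtilde a b <-> (endo_rank a == 1%N) = (endo_rank b == 1%N).
Proof.
pose J (x : endo 3) := principal_ideal (@Ltilde _) (@Rtilde _) x.
have J_full x : endo_rank x != 1%N -> forall y, J x y.
  move=> x1 y I Iid IL IR Ix.
  suff I1 : I 1 by rewrite -[y]mulg1; case: (Iid 1 y I1).
  have I2 z : endo_rank z = 2 -> I z -> I 1.
    have [c cC] := exists_C; move=> rz Iz.
    apply: (IL c).
      by apply/Ltilde_iff; right; rewrite !in_setU cC one_in_aut orbT.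
    apply: IR Iz; apply/Rtilde_eq_rank; rewrite rz.
    by apply/esym/eqP; rewrite -E2C_rank inE cC orbT.
  have := endo_rank_values x; rewrite !inE (negPf x1) orbF => /or3P[] /eqP rx.
  - by apply: IR Ix; apply/Rtilde_eq_rank; rewrite rx rank_one.
  - have [p pE] := exists_phi_1 (mul_cst (cst ord0) ord0 : _ * _ = _).
    have pr : endo_rank p = 2.
      apply/eqP; rewrite -E2C_rank inE (phi_in_E2 pE) eqxx.
      by rewrite (contraNneq _ (cst_singular ord0)) // => ->; rewrite symT1.
    apply: (I2 p pr); suff <- : x * p = p by case: (Iid x p Ix).
    have : x \in phiE3 3 by rewrite E3_rank rx.
    case: endo3P => // t e xE to tt eS _.
    have pt : p t = 1.
      by case/setDP: to => /imsetP[q _ ->] _; rewrite pE phi_perm mulg1 if_same.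
    have := phi_mulE xE p; rewrite pt (phi_val_sing pE eS) -pE.
    exact: val_inj.
  - exact: I2 Ix.
have J1 x y : endo_rank x = 1%N -> J x y -> endo_rank y = 1%N.
  move=> rx /(_ (fun z => endo_rank z = 1%N)); apply=> //.
  - move=> z w rz; have [_ zw] := rank_mul w z; have [wz _] := rank_mul z w.
    move: zw wz; rewrite rz.
    by have := endo_rank_values (w * z); have := endo_rank_values (z * w);
      rewrite !inE => /or4P[] /eqP-> /or4P[] /eqP->.
  - move=> z w /Ltilde_iff[->//|[zC _]] rz; move: zC.
    by rewrite in_setU aut_rank rz /=; move: rz; case: endo3P.
  - by move=> z w /Rtilde_eq_rank->.
split=> [ab|ab x].
  by apply/eqP/eqP=> r1; [apply: (J1 a b)|apply: (J1 b a)] => //; apply/ab;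
    apply: principal_ideal_self.
have [ra|ra] := boolP (endo_rank a == 1%N); last first.
  by split=> _; apply: J_full; rewrite // -ab.
have rb := ra; rewrite ab in rb.
have rab : endo_rank a = endo_rank b by rewrite (eqP ra) (eqP rb).
by split; apply: principal_ideal_trans; apply: principal_ideal_r;
  apply/Rtilde_eq_rank.
Qed.

(** * The classes *)

Theorem proposition7p2 :
  (* (1) *)
  ((forall a b : endo 3, Lstar a b -> Rstar a b) /\
   (forall a b : endo 3, Rstar a b <-> Dstar a b) /\
   (forall a b : endo 3, Dstar a b <-> Jstar a b) /\
   (forall a b : endo 3, Jstar a b <-> Rtilde a b) /\
   (forall X : {set endo 3},
      is_class (@Rstar (endo 3)) X <->
      X \in [:: aut_transf 3; phiE3 3; phiE2 3 :|: phiC 3; phiE1 3]) /\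
   (forall a b : endo 3, Rstar a b <-> endo_rank a = endo_rank b)) /\
  (* (2) *)
  (forall a b : endo 3,
     Ltilde a b <->
     a = b \/ (a \in aut_transf 3 :|: phiC 3 /\ b \in aut_transf 3 :|: phiC 3)) /\
  (* (3) *)
  (forall a b : endo 3,
     Lstar a b <->
     (a \in aut_transf 3 /\ b \in aut_transf 3) \/
     (a * a = a /\ a = b /\ b = b * b) \/
     (a \in phiC 3 /\ b \in phiC 3 /\
      exists t e u f : transf 3,
        endo_fun a = phi_te t e /\ endo_fun b = phi_te u f /\ Fix_te t e = Fix_te u f)) /\
  (* (4) *)
  (forall X : {set endo 3},
     is_class (@Dtilde (endo 3)) X <->
     X \in [:: aut_transf 3 :|: phiE2 3 :|: phiC 3; phiE3 3; phiE1 3]) /\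
  (* (5) *)
  (forall X : {set endo 3},
     is_class (@Jtilde (endo 3)) X <->
     X \in [:: ~: phiE1 3; phiE1 3]).
Proof.
have ranks k : k \in [:: 27; 3; 2; 1%N] -> exists a : endo 3, endo_rank a = k.
  have [c cC] := exists_C; have [d dE3] := exists_E3.
  rewrite !inE => /or4P[] /eqP->.
  - by exists 1; apply: rank_one.
  - by exists d; apply/eqP; rewrite -E3_rank.
  - by exists c; apply/eqP; rewrite -E2C_rank in_setU cC orbT.
  exists (c * c); apply/eqP; have [t [e cE]] := phiC_params cC.
  rewrite -E1_rank (phi_in_E1 (phi_mulE cE c)); move: cC; rewrite (phi_in_C cE).
  case/and4P=> tS _ _ e1; have [_ _ _ ee] := phi_axioms cE.
  by rewrite !(phi_val_sing cE) // idem_neq1_singular.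
split; last split; last split; last split.
- split; first exact: Lstar_Rstar.
  split=> [a b|].
    exact: iff_trans (Rstar_eq_rank a b) (iff_sym (Dstar_eq_rank a b)).
  split=> [a b|].
    exact: iff_trans (Dstar_eq_rank a b) (iff_sym (Jstar_eq_rank a b)).
  split=> [a b|].
    exact: iff_trans (Jstar_eq_rank a b) (iff_sym (Rtilde_eq_rank a b)).
  split; last exact: Rstar_eq_rank.
  have -> : [:: aut_transf 3; phiE3 3; phiE2 3 :|: phiC 3; phiE1 3] =
      [seq [set a | endo_rank a == k] | k <- [:: 27; 3; 2; 1%N]].
    congr [:: _; _; _; _]; apply/setP => a; rewrite [RHS]inE.
    - exact: aut_rank.
    - exact: E3_rank.
    - exact: E2C_rank.
    - exact: E1_rank.
  exact: is_class_levels Rstar_eq_rank endo_rank_values ranks.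
- exact: Ltilde_iff.
- exact: Lstar_iff.
- have -> : [:: aut_transf 3 :|: phiE2 3 :|: phiC 3; phiE3 3; phiE1 3] =
      [seq [set a | merged_rank a == k] | k <- [:: 2; 3; 1%N]].
    congr [:: _; _; _]; apply/setP => a; rewrite [RHS]inE /merged_rank.
    - by rewrite !in_setU; case: endo3P.
    - by case: endo3P.
    - by case: endo3P.
  apply: is_class_levels Dtilde_eq_merged_rank _ _ => [a|k].
    rewrite /merged_rank; have := endo_rank_values a.
    by rewrite !inE => /or4P[] /eqP->.
  move=> k3; have [|a ra] := ranks k.
    by move: k3; rewrite !inE => /or3P[] ->; rewrite ?orbT.
  exists a; rewrite /merged_rank ra; suff /negPf-> : k != 27 by [].
  by apply: contraTneq k3 => ->.
have -> : [:: ~: phiE1 3; phiE1 3] =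
    [seq [set a | (endo_rank a == 1%N) == k] | k <- [:: false; true]].
  congr [:: _; _]; apply/setP => a; rewrite [RHS]inE ?in_setC E1_rank;
    by case: eqP.
apply: is_class_levels Jtilde_eq_rank1 _ _ => [a|k _]; first by case: (_ == _).
have [|a ra] := ranks (if k then 1%N else 2); first by case: k.
by exists a; rewrite ra {ra}; case: k.
Qed.
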